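(* Let $K$ be a field of characteristic $\neq2$ with involution $a\mapsto\bar a$, and let $\Phi$ be an $n\times n$ Frobenius block with characteristic polynomial $\chi(x)=p(x)^s=x^n+\alpha_1x^{n-1}+\dots+\alpha_n$, $p$ monic irreducible. A nonsingular matrix $X$ with $X=X^*\Phi$ exists if and only if (A1) $\chi(x)=\chi^\vee(x)$, and (A2) $p(x)\neq x+(-1)^{n-1}$ in the case of the identity involution. When these hold, one can take $X=[a_{j-i}]_{i,j=1}^n$, where $a_{1-n},\dots,a_{n-1}$ are terms of the $\chi$-recurrent sequence determined by the fragment $(a_{-m},\dots,a_{m-1})=(\bar a,0,\dots,0,a)$ of length $2m\in\{n,n+1\}$, in which: (a) $a=1$ if $n=2m$, except when $p(x)=x+\alpha$ with $\alpha^{n-1}=-1$; (b) $a=k$ if $n=2m$, $p(x)=x+\alpha$, $\alpha^{n-1}=-1$, and also if $n=2m-1$, $p(x)=x+1$; (c) $a=\chi(-1)$ if $n=2m-1$, $p(x)\ne x+1$.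
   Context: $M^*=[\bar m_{ji}]$ for $M=[m_{ij}]$. For $f=a_0x^n+\dots+a_n$ with $a_n\ne0$, $f^\vee(x)=\bar a_n^{-1}(\bar a_nx^n+\dots+\bar a_1x+\bar a_0)$. A Frobenius block is an $n\times n$ matrix with ones on the subdiagonal, last column $(-c_n,\dots,-c_1)^T$, zeros elsewhere, and characteristic polynomial $x^n+c_1x^{n-1}+\dots+c_n$ a power of an irreducible polynomial. For $f(x)=\gamma_0x^m+\dots+\gamma_m$, a sequence $(a_q,\dots,a_r)$ is $f$-recurrent if $\gamma_0a_{l+m}+\gamma_1a_{l+m-1}+\dots+\gamma_ma_l=0$ for $q\le l\le r-m$. In the case of a nonidentity involution, $k$ denotes a fixed element with $k=-\bar k\ne0$. *)

(* Defs.v *)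
From HB Require Import structures.
From mathcomp Require Import all_boot all_order all_algebra.
Set Implicit Arguments. Unset Strict Implicit. Unset Printing Implicit Defensive.
Import Order.TTheory GRing.Theory Num.Theory.
Local Open Scope ring_scope.

Section Defs.
Variable K : fieldType.

Definition mxstar (cj : K -> K) (n : nat) (M : 'M[K]_n) : 'M[K]_n :=
  map_mx cj M^T.

(* For f = a_0 x^d + ... + a_d (a_d = f(0) <> 0):
   f^vee = cj(a_d)^-1 (cj(a_d) x^d + ... + cj(a_1) x + cj(a_0)),
   i.e. coefficient of x^i of the bracket is cj of coefficient of x^(d-i) of f. *)
Definition polyvee (cj : K -> K) (f : {poly K}) : {poly K} :=
  (cj f`_0)^-1 *: \poly_(i < size f) cj f`_((size f).-1 - i).

(* n x n Frobenius block of chi = x^n + c_1 x^(n-1) + ... + c_n (0-indexed):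
   ones on the subdiagonal, last column (-c_n, ..., -c_1)^T, i.e. the entry in
   row i of the last column is -c_(n-i) = - chi`_i, zeros elsewhere. *)
Definition frob_block (n : nat) (chi : {poly K}) : 'M[K]_n :=
  \matrix_(i < n, j < n)
    (if (i : nat) == j.+1 then 1
     else if (j : nat) == n.-1 then - chi`_i else 0).

(* (a_q, ..., a_r) is f-recurrent, f = g_0 x^d + ... + g_d (g_j = f`_(d-j)):
   g_0 a_(l+d) + ... + g_d a_l = 0 for q <= l <= r - d. *)
Definition recurrent (f : {poly K}) (a : int -> K) (q r : int) : Prop :=
  forall l : int, q <= l -> l + ((size f).-1)%:Z <= r ->
    \sum_(i < size f) f`_i * a (l + (i : nat)%:Z) = 0.

End Defs.

(* Main.v *)
(** For a Toeplitz matrix [X = [a_(j-i)]] with [a] a [chi]-recurrent sequence, the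
    equation [X = X^* Phi] follows from the symmetry [a_t = cj a_(-1-t)].  When
    [chi] is self-dual the reflected sequence is again [chi]-recurrent, so this
    symmetry need only be checked on [n] consecutive terms, which the fragment
    provides.  The matrix is singular iff some nonzero polynomial of degree [< n]
    in the shift annihilates [a], that is, iff [p^(s-1)] does; the zeros of the
    fragment rule this out.  Conversely [X = X^* Phi] gives [X = Phi^* X Phi]:
    congruence by [X] takes [Phi^-1] to [Phi^*], so the reversed conjugate of
    [chi] annihilates [Phi], which gives A1. *)
Require Import Defs.
From HB Require Import structures.
From mathcomp Require Import all_boot all_order all_algebra.
From Stdlib Require Import Classical_Prop Classical_Pred_Type.
From mathcomp Require Import zify.
Import Order.TTheory GRing.Theory Num.Theory.
Local Open Scope ring_scope.

Set Implicit Arguments.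
Unset Strict Implicit.

(** * Polynomials in the shift operator acting on sequences *)

Section ShiftAction.
Variable K : fieldType.
Implicit Types (f g p chi : {poly K}) (a b : int -> K) (l : int).

(* [f] acts on bi-infinite sequences as a polynomial in the shift operator. *)
Definition act f a l : K := \sum_(i < size f) f`_i * a (l + (i : nat)%:Z).

Lemma act_widen N f a l : (size f <= N)%N ->
  act f a l = \sum_(i < N) f`_i * a (l + (i : nat)%:Z).
Proof.
move=> sfN; rewrite /act (big_ord_widen N (fun i => f`_i * a (l + i%:Z)) sfN).
rewrite big_mkcond /=; apply: eq_bigr => i _; case: ltnP => // sfi.
by rewrite nth_default ?mul0r.
Qed.

Lemma eq_act f a b : a =1 b -> act f a =1 act f b.
Proof. by move=> eab l; apply: eq_bigr => i _; rewrite eab. Qed.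

Lemma act0 f l : act f (fun=> 0) l = 0.
Proof. by rewrite /act big1 // => i _; rewrite mulr0. Qed.

Lemma act_eq0 f a : (forall l, a l = 0) -> forall l, act f a l = 0.
Proof. by move=> a0 l; rewrite (eq_act f (b := fun=> 0)) ?act0. Qed.

Lemma actD f g a l : act (f + g) a l = act f a l + act g a l.
Proof.
rewrite !(@act_widen (maxn (size f) (size g))) ?leq_maxl ?leq_maxr ?size_polyD //.
by rewrite -big_split; apply: eq_bigr => i _; rewrite coefD mulrDl.
Qed.

Lemma actC c a l : act c%:P a l = c * a l.
Proof.
by rewrite (@act_widen 1) ?size_polyC ?leq_b1 // big_ord1 coefC addr0.
Qed.

Lemma actMX f a l : act (f * 'X) a l = act f a (l + 1).
Proof.
have sz : (size (f * 'X)%R <= (size f).+1)%N.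
  by apply: leq_trans (size_polyMleq _ _) _; rewrite size_polyX addn2.
rewrite (act_widen _ _ sz) big_ord_recl coefMX mul0r add0r.
apply: eq_bigr => i _; rewrite coefMX /=.
by rewrite -addrA -[1%R]/(1%:Z) -PoszD.
Qed.

Lemma actZ c f a l : act (c *: f) a l = c * act f a l.
Proof.
rewrite (@act_widen (size f)) ?size_scale_leq // /act mulr_sumr.
by apply: eq_bigr => i _; rewrite coefZ mulrA.
Qed.

Lemma actM f g a l : act (f * g) a l = act f (act g a) l.
Proof.
elim/poly_ind: f l => [|f c IHf] l.
  by rewrite mul0r /act size_poly0 !big_ord0.
rewrite mulrDl actD mulrAC actMX IHf actD actMX actC mul_polyC.
by rewrite actZ.
Qed.

Lemma act_comm_eq0 f g a :
  (forall l, act g a l = 0) -> forall l, act g (act f a) l = 0.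
Proof. by move=> ga l; rewrite -actM mulrC actM act_eq0. Qed.

Lemma act_monic f a l n : f \is monic -> size f = n.+1 ->
  act f a l = a (l + n%:Z) + \sum_(i < n) f`_i * a (l + (i : nat)%:Z).
Proof.
move=> mf sf; rewrite /act sf big_ord_recr /= addrC.
by have := monicP mf; rewrite lead_coefE sf /= => ->; rewrite mul1r.
Qed.

(** A window of [n] zeros spreads to the right because [chi] is monic, and to the left because its
    constant coefficient is nonzero. *)
Lemma recurrent_zero chi n a l0 : chi \is monic -> size chi = n.+1 ->
    chi`_0 != 0 -> (0 < n)%N -> (forall l, act chi a l = 0) ->
    (forall i, (i < n)%N -> a (l0 + i%:Z) = 0) ->
  forall l, a l = 0.
Proof.
move=> mchi szchi c0 n_gt0 ra a0.
have fwd k i : (i < n)%N -> a (l0 + k%:Z + i%:Z) = 0.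
  elim: k i => [|k IHk] i ltin; first by rewrite addr0 a0.
  have [ltiSn | leni] := ltnP i.+1 n.
    by rewrite -(IHk _ ltiSn); congr (a _); lia.
  have := ra (l0 + k%:Z); rewrite (act_monic _ _ mchi szchi).
  rewrite big1 ?addr0 => [|j _]; last by rewrite IHk ?mulr0.
  by move=> <-; congr (a _); lia.
have bwd k i : (i < n)%N -> a (l0 - k%:Z + i%:Z) = 0.
  elim: k i => [|k IHk] i ltin; first by rewrite subr0 a0.
  case: i ltin => [|i] ltin; last first.
    by rewrite -(IHk i (ltnW ltin)); congr (a _); lia.
  have := ra (l0 - k.+1%:Z); rewrite /act szchi big_ord_recl big1 ?addr0.
    by move/eqP; rewrite mulf_eq0 (negPf c0) => /eqP.
  move=> j _; rewrite lift0 -[a _](_ : a (l0 - k%:Z + (j : nat)%:Z) = _).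
    by rewrite IHk ?mulr0.
  by congr (a _); lia.
move=> l; case: (lerP l0 l) => hl.
  by rewrite -(fwd `|l - l0|%N 0%N) //; congr (a _); lia.
by rewrite -(bwd `|l - l0|%N 0%N) //; congr (a _); lia.
Qed.

Lemma recurrent_unique chi n a b l0 : chi \is monic -> size chi = n.+1 ->
    chi`_0 != 0 -> (0 < n)%N ->
    (forall l, act chi a l = 0) -> (forall l, act chi b l = 0) ->
    (forall i, (i < n)%N -> a (l0 + i%:Z) = b (l0 + i%:Z)) ->
  a =1 b.
Proof.
move=> mchi szchi c0 n_gt0 ra rb ab l; apply/eqP; rewrite -subr_eq0; apply/eqP.
apply: (@recurrent_zero chi n (fun l => a l - b l) l0) => // [k|i lin].
  have -> : act chi (fun l => a l - b l) k = act chi a k - act chi b k.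
    by rewrite /act -sumrB; apply: eq_bigr => i _; rewrite mulrBr.
  by rewrite ra rb subrr.
by rewrite ab // subrr.
Qed.

Lemma act_coprime f g a : coprimep f g ->
    (forall l, act f a l = 0) -> (forall l, act g a l = 0) ->
  forall l, a l = 0.
Proof.
case/Bezout_coprimepP=> -[u v] /= /eqpP[[c d] /= /andP[c0 d0] e] fa ga l.
have : act (c *: (u * f + v * g)) a l = 0.
  by rewrite actZ actD !actM !(act_eq0 _ fa, act_eq0 _ ga) addr0 mulr0.
rewrite e -mul_polyC mulr1 actC => /eqP.
by rewrite mulf_eq0 (negPf d0) => /eqP.
Qed.

(** The annihilators of [a] form an ideal containing the gcd of [f] and [p ^+ k.+1]; this is a
    proper divisor of [p ^+ k.+1], hence divides [p ^+ k]. The induction moves one factor [p] at a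
    time from [f] onto the sequence. *)
Lemma act_irreducible_power p f a k : irreducible_poly p ->
    ~~ (p ^+ k.+1 %| f) ->
    (forall l, act (p ^+ k.+1) a l = 0) -> (forall l, act f a l = 0) ->
  forall l, act (p ^+ k) a l = 0.
Proof.
move=> irr; elim: k f a => [|k IHk] f a ndv pa fa l.
  apply: act_eq0; apply: act_coprime fa; last exact: pa.
  by rewrite expr1 irreducible_poly_coprime.
have [/dvdpP[g def_f]|ndvpf] := boolP (p %| f).
  rewrite exprSr actM; apply: (IHk g).
  - by move: ndv; rewrite def_f [p ^+ k.+2]exprSr dvdp_mul2r // irredp_neq0.
  - by move=> j; rewrite -actM -exprSr.
  - by move=> j; rewrite -actM -def_f.
apply: act_eq0; apply: act_coprime pa fa.
by rewrite coprimep_expl // irreducible_poly_coprime.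
Qed.

Lemma irreducible_power_degree_gt0 p k n :
  irreducible_poly p -> size (p ^+ k.+1) = n.+1 -> (0 < n)%N.
Proof.
move=> [sp _] sz; have := size_exp p k.+1; rewrite sz /= => ->.
by rewrite muln_gt0 andbT -subn1 subn_gt0.
Qed.

(** A kernel vector lists the coefficients of a polynomial [f] of degree below [n], and the kernel
    equations say that [act f a] vanishes at the places [1 - n, ..., 0]. Being recurrent itself,
    [act f a] is then zero, which forces [p ^+ k] to annihilate [a]. *)
Lemma toeplitz_unitmx p k n a l :
    p \is monic -> irreducible_poly p -> size (p ^+ k.+1) = n.+1 ->
    (p ^+ k.+1)`_0 != 0 -> (forall j, act (p ^+ k.+1) a j = 0) ->
    act (p ^+ k) a l != 0 ->
  \matrix_(i < n, j < n) a ((j : nat)%:Z - (i : nat)%:Z) \in unitmx.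
Proof.
move=> mp irr sz c0 ra nz; rewrite -unitmx_tr -row_free_unit.
have n_gt0 := irreducible_power_degree_gt0 irr sz.
apply: inj_row_free => v vX0; apply/eqP/negPn/negP => v0.
pose f := rVpoly v.
have f0 : f != 0.
  by apply: contraNneq v0 => f0; rewrite -(rVpolyK v) -/f f0 linear0.
have szf : (size f <= n)%N by exact: size_poly.
have fa : forall l, act f a l = 0.
  apply: (@recurrent_zero _ n _ (1 - n%:Z) _ sz c0 n_gt0).
  - by rewrite monic_exp.
  - exact: act_comm_eq0.
  (* Place [1 - n + i] corresponds to row [n - 1 - i] of the Toeplitz matrix. *)
  move=> i ltin; pose i' := rev_ord (Ordinal ltin).
  have := congr1 (fun M : 'rV_n => M 0 i') vX0; rewrite !mxE => <-.
  rewrite (act_widen _ _ szf); apply: eq_bigr => j _.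
  rewrite coef_rVpoly_ord !mxE; congr (_ * a _); rewrite /=; lia.
move/eqP: nz; apply; apply: act_irreducible_power fa l => //.
by apply/negP => /(dvdp_leq f0); rewrite sz leqNgt ltnS szf.
Qed.

End ShiftAction.

(** * The Frobenius block as a companion matrix with a cyclic vector *)

Section FrobeniusBlock.
Variables (K : fieldType) (n : nat) (chi : {poly K}).
Hypotheses (monic_chi : chi \is monic) (size_chi : size chi = n.+2).

(** Row vectors model polynomials modulo [chi]: right multiplication by [C] is multiplication by the
    variable, and [e0] is the constant 1. *)
Let C : 'M[K]_n.+1 := (frob_block n.+1 chi)^T.
Let e0 : 'rV[K]_n.+1 := delta_mx 0 0.

Lemma frob_trE i j : C i j =
  if (j : nat) == i.+1 then 1 else if (i : nat) == n then - chi`_j else 0.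
Proof. by rewrite !mxE. Qed.

Lemma frob_cyclic (i : 'I_n.+1) : e0 *m C ^+ i = delta_mx 0 i.
Proof.
case: i => i ltin; elim: i ltin => [|i IHi] ltin /=.
  by rewrite expr0 mulmx1; congr delta_mx; apply: val_inj.
have -> : C ^+ i.+1 = C ^+ i *m C by rewrite exprSr.
rewrite mulmxA (IHi (ltnW ltin)) -rowE.
apply/rowP=> j; rewrite [LHS]mxE frob_trE [RHS]mxE /= -val_eqE /=.
by rewrite (ltn_eqF (ltin : (i < n)%N)); case: eqP.
Qed.

Lemma frob_horner (g : {poly K}) : (size g <= n.+1)%N ->
  e0 *m horner_mx C g = poly_rV g.
Proof.
move=> sg; have {1}-> : g = \sum_(i < n.+1) g`_i *: 'X^i.
  rewrite -poly_def; apply/polyP => i; rewrite coef_poly.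
  by case: ltnP => // h; rewrite nth_default // (leq_trans sg h).
rewrite linear_sum mulmx_sumr; apply/rowP => j; rewrite summxE [RHS]mxE.
rewrite (bigD1 j) //= big1 ?addr0 => [|i nij];
  rewrite linearZ /= rmorphXn /= horner_mx_X -scalemxAr frob_cyclic !mxE eqxx.
  by rewrite eqxx mulr1.
by rewrite eq_sym (negPf nij) mulr0.
Qed.

Lemma frob_Xn : e0 *m C ^+ n.+1 = - poly_rV (take_poly n.+1 chi).
Proof.
have -> : C ^+ n.+1 = C ^+ (ord_max : 'I_n.+1) *m C by rewrite exprSr.
rewrite mulmxA frob_cyclic -rowE; apply/rowP=> j.
by rewrite [LHS]mxE frob_trE !mxE coef_take_poly ltn_ord (ltn_eqF (ltn_ord j)) eqxx.
Qed.

Lemma frob_annul : horner_mx C chi = 0.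
Proof.
have def_chi : chi = 'X^(n.+1) + take_poly n.+1 chi.
  apply/polyP => i; rewrite coefD coefXn coef_take_poly.
  case: (ltngtP i n.+1) => [_|h|->]; first by rewrite add0r.
    by rewrite addr0 nth_default // size_chi.
  by rewrite addr0; have := monicP monic_chi; rewrite lead_coefE size_chi => ->.
have e0chi : e0 *m horner_mx C chi = 0.
  rewrite {1}def_chi rmorphD /= rmorphXn /= horner_mx_X mulmxDr frob_Xn.
  by rewrite frob_horner ?size_take_poly // addNr.
(* Polynomials in [C] commute, so what kills the cyclic vector [e0] kills every basis vector
   [e0 *m C ^+ i]. *)
apply/row_matrixP => i; rewrite row0 rowE -frob_cyclic -mulmxA.
have -> : C ^+ i *m horner_mx C chi = horner_mx C chi *m C ^+ i.
  have -> : C ^+ i = horner_mx C 'X^i by rewrite rmorphXn /= horner_mx_X.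
  by rewrite -[LHS]rmorphM mulrC rmorphM.
by rewrite mulmxA e0chi mul0mx.
Qed.

Lemma frob_min (g : {poly K}) :
  (size g <= n.+1)%N -> horner_mx C g = 0 -> g = 0.
Proof.
move=> sg gC; rewrite -(poly_rV_K sg) -frob_horner // gC mulmx0.
by rewrite linear0.
Qed.

Lemma frob_unit : (C \is a GRing.unit) = (chi`_0 != 0).
Proof.
apply/idP/idP => [uC | c0].
  apply/eqP => c0; have : C *m delta_mx 0 0 = 0 :> 'cV[K]_n.+1.
    rewrite -colE; apply/matrixP => i j; rewrite !mxE /=.
    by rewrite c0 oppr0 if_same.
  move/(congr1 (mulmx (invmx C))); rewrite mulKmx // mulmx0.
  by move/matrixP/(_ 0 0); rewrite !mxE /= => /eqP; rewrite oner_eq0.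
(* Write [chi] minus its constant term as [q * 'X]; evaluating at [C] shows a scalar multiple of
   q(C) to be the inverse of [C]. *)
have : root (chi - (chi`_0)%:P) 0 by rewrite /root hornerD hornerN hornerC horner_coef0 subrr.
case/factor_theorem => q; rewrite subr0 => /(congr1 (horner_mx C)).
rewrite rmorphB rmorphM /= frob_annul sub0r horner_mx_C horner_mx_X => e.
have [|_] // := @mulmx1_unit _ _ (- (chi`_0)^-1 *: horner_mx C q) C.
rewrite -scalemxAl -[_ *m C]e -(scalemx1 _ chi`_0).
by rewrite scalerN scaleNr opprK scalerA mulVf // scale1r.
Qed.

Lemma exists_recurrent (w : nat -> K) (l0 : int) : chi`_0 != 0 ->
  exists2 a : int -> K, (forall l, act chi a l = 0) &
    forall i, (i < n.+1)%N -> a (l0 + i%:Z) = w i.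
Proof.
rewrite -frob_unit => uC; pose W : 'cV[K]_n.+1 := \col_i w i.
(* A matrix coefficient along the orbit of [e0]: invertibility of [C] supplies the negative powers,
   and chi(C) = 0 is the recurrence. *)
exists (fun t => (e0 *m C ^ (t - l0) *m W) 0 0) => [l|i ltin].
  rewrite /act; transitivity ((e0 *m (C ^ (l - l0) *m horner_mx C chi) *m W) 0 0).
    rewrite -[chi in horner_mx C chi]coefK poly_def linear_sum !mulmx_sumr mulmx_suml summxE.
    apply: eq_bigr => i _.
    rewrite linearZ /= rmorphXn /= horner_mx_X -!scalemxAr -scalemxAl [RHS]mxE.
    congr (_ * (_ *m _ *m _) _ _); rewrite addrAC.
    exact: exprzDr.
  by rewrite frob_annul mulmx0 mulmx0 mul0mx mxE.
have -> : l0 + i%:Z - l0 = i by rewrite addrC addKr.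
by rewrite -exprnP (frob_cyclic (Ordinal ltin)) -rowE !mxE.
Qed.

End FrobeniusBlock.

(** * Recurrent sequences under reflection and conjugation *)

Section SelfDualSequences.
Variables (K : fieldType) (cj : {rmorphism K -> K}).
Implicit Types (chi p : {poly K}) (a : int -> K).

(** Passes from a finite window to a bi-infinite sequence, to which the shift action applies. The
    first [n] terms determine [b], and the monic recurrence carries the agreement to the end of the
    window. *)
Lemma recurrent_extension chi n a (lo hi : int) : chi \is monic -> size chi = n.+1 ->
    chi`_0 != 0 -> (0 < n)%N -> lo + n%:Z - 1 <= hi -> recurrent chi a lo hi ->
  exists2 b : int -> K, (forall l, act chi b l = 0) &
    forall l, lo <= l <= hi -> a l = b l.
Proof.
move=> mchi szchi c0 n_gt0 wide ra; case: n => // n in szchi n_gt0 wide *.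
have [b rb ab] := exists_recurrent mchi szchi (fun i => a (lo + i%:Z)) lo c0.
exists b => // l /andP[lol lhi].
have -> : l = lo + `|l - lo|%N by lia.
have : lo + `|l - lo|%N%:Z <= hi by lia.
elim/ltn_ind: `|l - lo|%N => k IHk khi.
have [ltkn|lenk] := ltnP k n.+1; first by rewrite ab.
have rak : act chi a (lo + (k - n.+1)%N%:Z) = 0 by apply: ra; rewrite ?szchi /=; lia.
have := rb (lo + (k - n.+1)%N%:Z); rewrite -{}rak !(act_monic _ _ mchi szchi).
have -> : lo + (k - n.+1)%N%:Z + n.+1%:Z = lo + k%:Z by lia.
rewrite [X in _ + X = _ -> _](_ : _ = \sum_(i < n.+1)
    chi`_i * a (lo + (k - n.+1)%N%:Z + (i : nat)%:Z)) => [/addIr//|].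
apply: eq_bigr => i _; congr (_ * _); have ltin := ltn_ord i.
have -> : lo + (k - n.+1)%N%:Z + (i : nat)%:Z = lo + (k - n.+1 + i)%N%:Z by lia.
by rewrite IHk //; lia.
Qed.

Lemma polyvee_coef chi n i : chi = polyvee cj chi -> size chi = n.+1 -> (i <= n)%N ->
  chi`_i = (cj chi`_0)^-1 * cj chi`_(n - i).
Proof. by move=> dual sz lein; rewrite [in LHS]dual coefZ coef_poly sz ltnS lein. Qed.

Lemma act_reflect chi a : chi = polyvee cj chi -> (forall l, act chi a l = 0) ->
  forall l, act chi (fun t => cj (a (- 1 - t))) l = 0.
Proof.
move=> dual ra l; case szE: (size chi) => [|n].
  by rewrite /act szE big_ord0.
(* The recurrence at [- 1 - l - n] involves exactly the mirror images of the places [l, ..., l + n];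
   self-duality restores the order of the coefficients. *)
have := congr1 cj (ra (- 1 - l - n%:Z)); rewrite rmorph0 /act szE.
move/(congr1 ( *%R (cj chi`_0)^-1)); rewrite mulr0; apply: etrans.
rewrite (reindex_inj rev_ord_inj) rmorph_sum mulr_sumr; apply: eq_bigr => i _ /=.
rewrite rmorphM mulrA (polyvee_coef dual szE) /=; last by have := ltn_ord i; lia.
by rewrite subKn; [congr (_ * cj (a _))|]; have := ltn_ord i; lia.
Qed.

(** By the symmetry, [X^*] is the Toeplitz matrix of [a] displaced by one place. The subdiagonal
    ones of the block undo the displacement, and in the last column each row is one instance of the
    recurrence. *)
Lemma toeplitz_cosquare chi n a : chi \is monic -> size chi = n.+1 ->
    (forall l, act chi a l = 0) -> (forall t, a t = cj (a (- 1 - t))) ->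
  let X := \matrix_(i < n, j < n) a ((j : nat)%:Z - (i : nat)%:Z) in
  X = mxstar cj X *m frob_block n chi.
Proof.
move=> mchi szchi ra sym X; apply/matrixP => i j; rewrite !mxE.
under eq_bigr => k _.
  rewrite !mxE [cj _](_ : _ = a ((k : nat)%:Z - (i : nat)%:Z - 1)); last first.
    by rewrite [RHS]sym; congr (cj (a _)); lia.
  over.
have [lt_jn | ge_jn] := ltnP j.+1 n.
  rewrite (bigD1 (Ordinal lt_jn)) //= eqxx mulr1 big1 ?addr0.
    by congr (a _); lia.
  move=> k; rewrite -val_eqE /= => /negPf->.
  by rewrite ltn_eqF ?mulr0 //; lia.
have ltjn := ltn_ord j; have def_j : (j : nat) = n.-1 by lia.
have := ra (- (i : nat)%:Z - 1); rewrite (act_monic _ _ mchi szchi).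
move/eqP; rewrite addr_eq0 => /eqP.
have -> : - (i : nat)%:Z - 1 + n%:Z = (j : nat)%:Z - (i : nat)%:Z by lia.
move=> ->; rewrite -sumrN; apply: eq_bigr => k _.
rewrite ltn_eqF; last by have := ltn_ord k; lia.
by rewrite def_j eqxx mulrN mulrC; congr (- (a _ * _)); lia.
Qed.

End SelfDualSequences.

(** * Conditions forced by a nonsingular solution *)

Section CosquareNecessity.
Variables (K : fieldType) (n : nat) (chi : {poly K}) (cj : {rmorphism K -> K}).
Variable X : 'M[K]_n.+1.
Hypotheses (monic_chi : chi \is monic) (size_chi : size chi = n.+2).
Hypotheses (cjK : involutive cj) (unitX : X \in unitmx).
Hypothesis eqX : X = mxstar cj X *m frob_block n.+1 chi.

Let C : 'M[K]_n.+1 := (frob_block n.+1 chi)^T.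
Let Cb : 'M[K]_n.+1 := map_mx cj C.

Lemma cosquare_coef0 : chi`_0 != 0.
Proof.
rewrite -(frob_unit monic_chi size_chi) -/C.
have : X \in unitmx := unitX; rewrite {1}eqX unitmx_mul => /andP[_].
by rewrite -unitmx_tr.
Qed.

(** Starring the equation gives [X^* = Phi^* X], which is substituted back; here [Cb] is [Phi^*] and
    [C^T] is [Phi]. *)
Lemma cosquare_isometry : Cb *m X *m C^T = X.
Proof.
rewrite trmxK {2}eqX; congr (_ *m _).
rewrite {2}eqX /mxstar trmx_mul map_mxM /= -/C -/Cb; congr (_ *m _).
by apply/matrixP => i j; rewrite !mxE cjK.
Qed.

Lemma cosquare_isometryX i : Cb ^+ i *m X *m (C ^+ i)^T = X.
Proof.
elim: i => [|i IHi]; first by rewrite !expr0 trmx1 mulmx1 mul1mx.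
rewrite !exprSr -[C ^+ i * C]/(C ^+ i *m C) -[Cb ^+ i * Cb]/(Cb ^+ i *m Cb).
by rewrite trmx_mul !mulmxA -[_ *m Cb *m X]mulmxA -[_ *m (Cb *m X) *m _]mulmxA
  cosquare_isometry.
Qed.

Lemma cosquare_polyvee : chi = polyvee cj chi.
Proof.
have c0 : cj chi`_0 != 0 by rewrite fmorph_eq0 cosquare_coef0.
rewrite /polyvee size_chi /=; set g := \poly_(i < _) _.
have sg : (size g <= n.+2)%N by apply: size_poly.
have gC : horner_mx C g = 0.
  apply: trmx_inj; rewrite trmx0 -[LHS](mulKmx unitX).
  rewrite [X *m _](_ : _ = 0) ?mulmx0 // /g poly_def !linear_sum.
  have := map_horner_mx cj C chi.
  rewrite (frob_annul monic_chi size_chi) raddf0 -/Cb.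
  rewrite -[chi in map_poly _ chi]coefK size_chi poly_def !linear_sum /=.
  (* The conjugate of [chi] kills [Cb]. After multiplication by [X (C^(n+1))^T], the isometry turns
     the term with [Cb^i] into [X (C^(n+1-i))^T], which reverses the coefficients and yields [g]. *)
  move/(congr1 (fun M => M *m X *m (C ^+ n.+1)^T)); rewrite !mul0mx => e.
  apply: etrans (esym e).
  rewrite !mulmx_suml (reindex_inj rev_ord_inj); apply: eq_bigr => i _ /=.
  rewrite map_polyZ map_polyXn !linearZ /= !rmorphXn /= !horner_mx_X.
  rewrite -!scalemxAl subSS subKn; last by rewrite -ltnS.
  congr (_ *: _).
  have -> : C ^+ n.+1 = C ^+ (n.+1 - i) *m C ^+ i.
    by rewrite -[RHS]exprD subnK // -ltnS.
  by rewrite trmx_mul !mulmxA cosquare_isometryX.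
(* The top coefficients cancel, so the difference is short enough for [frob_min]. *)
have /eqP : g - cj chi`_0 *: chi = 0.
  apply: (@frob_min _ n chi); last first.
    by rewrite rmorphB /= linearZ /= gC (frob_annul monic_chi size_chi) scaler0 subr0.
  apply/leq_sizeP => j; rewrite leq_eqVlt coefB coefZ => /orP[/eqP<-|ltnj].
    rewrite coef_poly ltnSn subnn.
    by have := monicP monic_chi; rewrite lead_coefE size_chi => ->; rewrite mulr1 subrr.
  by rewrite [chi`_j]nth_default ?size_chi // nth_default ?(leq_trans sg) // mulr0 subr0.
by rewrite subr_eq0 => /eqP->; rewrite scalerA mulVf // scale1r.
Qed.

End CosquareNecessity.

(* With N = C - eps, the form (u, v) |-> u N^n X v has rank one and is skew, because
   eps = (-1)^(n+1); in characteristic not 2 it therefore vanishes. *)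
Lemma cosquare_identity_excluded (K : fieldType) n (X : 'M[K]_n.+1) :
    let chi := ('X + ((-1) ^+ n)%:P) ^+ n.+1 in
    (2%:R : K) != 0 -> X \in unitmx -> X = X^T *m frob_block n.+1 chi -> False.
Proof.
move=> chi two_neq0 unitX eqX.
have [eps def_eps] : {eps : K | eps = - (-1) ^+ n} by exists (- (-1) ^+ n).
pose p : {poly K} := 'X + ((-1) ^+ n)%:P.
have mp : p \is monic by apply: monicXaddC.
have sp k : size (p ^+ k) = k.+1.
  have sz_gt0 : (0 < size (p ^+ k)%R)%N by rewrite size_poly_gt0 monic_neq0 ?monic_exp.
  by rewrite -(prednK sz_gt0) size_exp /p size_XaddC mul1n.
have mchi : chi \is monic by rewrite monic_exp.
have eps2 : eps * eps = 1 by rewrite def_eps mulrNN -expr2 sqrr_sign.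
pose C := (frob_block n.+1 chi)^T; pose N : 'M[K]_n.+1 := C - eps%:M.
pose e0 : 'rV[K]_n.+1 := delta_mx 0 0.
have defN : horner_mx C p = N.
  by rewrite rmorphD /= horner_mx_X horner_mx_C /N def_eps raddfN opprK.
have iso : C *m X *m C^T = X.
  rewrite trmxK {2}eqX; congr (_ *m _).
  by rewrite {2}eqX trmx_mul trmxK.
(* In coordinates [w] is [p ^+ n], nonzero by its degree; one more factor [N] gives chi(C) = 0, so
   [w] is an eigenvector of [C] for [eps]. *)
pose w := e0 *m N ^+ n.
have w0 : w != 0.
  rewrite /w -defN -rmorphXn /= frob_horner ?sp //.
  apply/eqP => /(congr1 rVpoly); rewrite poly_rV_K ?sp // linear0.
  by apply/eqP; rewrite monic_neq0 ?monic_exp.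
have wC : w *m C = eps *: w.
  have : w *m N = 0.
    by rewrite /w -mulmxA -[_ *m N]exprSr -defN -rmorphXn /= frob_annul ?mulmx0 ?sp.
  by rewrite mulmxBr mul_mx_scalar => /eqP; rewrite subr_eq0 => /eqP.
have wXC : w *m X *m C^T = eps *: (w *m X).
  by rewrite -[in RHS]iso !mulmxA wC -!scalemxAl scalerA eps2 scale1r.
have CXw : C *m X *m w^T = eps *: (X *m w^T).
  rewrite -[X in RHS]iso -[_ *m C^T *m _]mulmxA -trmx_mul wC linearZ /=.
  by rewrite -scalemxAr scalerA eps2 scale1r.
have CXwn k : C ^+ k *m X *m w^T = eps ^+ k *: (X *m w^T).
  elim: k => [|k IHk]; first by rewrite !expr0 mul1mx scale1r.
  rewrite !exprSr -[C ^+ k * C]/(C ^+ k *m C) -!mulmxA [C *m _]mulmxA CXw.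
  by rewrite -scalemxAr mulmxA IHk scalerA mulrC.
(* By the isometry, [N] is skew-adjoint up to [C] and a scalar; iterating carries [N ^+ n] from one
   side of the form to the other. *)
have CXN : C *m X *m N^T = - eps *: (N *m X).
  rewrite /N [in LHS]raddfB /= tr_scalar_mx mulmxBr iso mul_mx_scalar.
  by rewrite mulmxBl mul_scalar_mx scaleNr scalerBr scalerA eps2 scale1r opprB.
have comCN k : C ^+ k *m N = N *m C ^+ k.
  apply: commr_sym; apply: commrX; apply: commr_sym; apply: commrB => //.
  exact: comm_mx_scalar.
have CXNk k : C ^+ k *m X *m (N ^+ k)^T = (- eps) ^+ k *: (N ^+ k *m X).
  elim: k => [|k IHk]; first by rewrite !expr0 trmx1 mul1mx mulmx1 scale1r.
  rewrite [N ^+ k.+1 in LHS]exprSr [C ^+ k.+1]exprSr.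
  rewrite -[C ^+ k * C]/(C ^+ k *m C) -[N ^+ k * N]/(N ^+ k *m N) trmx_mul.
  rewrite !mulmxA -[_ *m C *m X]mulmxA -[_ *m (C *m X) *m _]mulmxA CXN.
  rewrite -scalemxAr -scalemxAl mulmxA comCN -!mulmxA [C ^+ k *m _]mulmxA IHk.
  by rewrite -scalemxAr scalerA -exprS [N ^+ k.+1]exprS -[N * _]/(N *m N ^+ k) -mulmxA.
pose b := w *m X *m e0^T.
have tr11 (M : 'M[K]_1) : M^T = M by apply/matrixP => i j; rewrite !ord1 mxE.
(* Since [X = X^T Phi], exchanging the two arguments of the form costs one application of [C], here
   the factor [eps]. *)
have bT : e0 *m X *m w^T = eps *: b.
  rewrite eqX -!mulmxA -[frob_block _ _]trmxK -/C -trmx_mul wC linearZ /=.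
  by rewrite -!scalemxAr -[_ *m _]tr11 !trmx_mul !trmxK.
(* Pairing with [e0] on both sides compares [eps ^+ n.+1] times [b] with [(- eps) ^+ n] times [b].
   As (-1)^n = -eps, these factors are opposite, so twice a unit kills [b]. *)
have b0 : b = 0.
  have /(congr1 (fun M => e0 *m (M *m e0^T))) := CXNk n.
  rewrite -mulmxA -trmx_mul -/w CXwn -!scalemxAl -!scalemxAr mulmxA bT !mulmxA -/b.
  rewrite exprNn scalerA -[(_ * _) *: b]scalerA scalerA.
  have : eps ^+ n != 0.
    by rewrite expf_neq0 // -unitfE; apply/unitrP; exists eps.
  move=> en e; have {e} : (eps ^+ n * eps) *: b = (eps ^+ n * - eps) *: b.
    by rewrite e def_eps opprK mulrC.
  move/eqP; rewrite -subr_eq0 -scalerBl mulrN opprK -mulr2n -mulr_natl scaler_eq0.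
  rewrite !mulf_eq0 (negPf two_neq0) (negPf en) /= => /orP[/eqP eps0|/eqP//].
  by move/eqP: eps2; rewrite eps0 mulr0 eq_sym oner_eq0.
(* The vector [w *m X] is an eigenvector of [C^T], so its pairing with each [e0 *m C ^+ i] is a
   multiple of [b]. *)
have wX0 : w *m X = 0.
  apply/rowP => i; rewrite [RHS]mxE.
  have wXn k : w *m X *m (C ^+ k)^T = eps ^+ k *: (w *m X).
    elim: k => [|k IHk]; first by rewrite !expr0 trmx1 mulmx1 scale1r.
    rewrite exprSr -[C ^+ k * C]/(C ^+ k *m C) trmx_mul mulmxA wXC.
    by rewrite -scalemxAl IHk scalerA -exprS.
  have : w *m X *m (e0 *m C ^+ i)^T = 0.
    by rewrite trmx_mul mulmxA wXn -scalemxAl -/b b0 scaler0.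
  by rewrite frob_cyclic trmx_delta -colE => /matrixP/(_ 0 0); rewrite !mxE.
by move: w0; rewrite -(mulmxK unitX w) wX0 mul0mx eqxx.
Qed.

(** * Solutions built from symmetric fragments *)

Section Fragments.
Variables (K : fieldType) (cj : {rmorphism K -> K}).
Hypothesis cjK : involutive cj.

Definition fragment (m : nat) (a0 : K) (a : int -> K) :=
  a (- m%:Z) = cj a0 /\ a (m%:Z - 1) = a0 /\
  (forall i : int, - m%:Z < i -> i < m%:Z - 1 -> a i = 0).

(** The fragment is centred at -1/2, the fixed point of [t |-> - 1 - t], and has at least [n] terms;
    so [a] and its reflection agree on enough terms to coincide. *)
Lemma fragment_symmetric chi n a0 a : chi \is monic -> size chi = n.+1 ->
    (0 < n)%N -> chi`_0 != 0 -> chi = polyvee cj chi ->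
    (forall l, act chi a l = 0) -> fragment (uphalf n) a0 a ->
  forall t, a t = cj (a (- 1 - t)).
Proof.
set m := uphalf n => mchi szchi n_gt0 c0 dual ra [fl [fr fz]].
apply: (recurrent_unique (l0 := - m%:Z) mchi szchi c0 n_gt0 ra).
  exact: act_reflect.
move=> i ltin; have le_n2m : (n <= m + m)%N by rewrite /m; lia.
have [i0|i_gt0] := posnP i.
  by rewrite i0 addr0 fl -fr; congr (cj (a _)); lia.
have [ei|ne] := eqVneq i (m + m).-1.
  have -> : - m%:Z + i%:Z = m%:Z - 1 by lia.
  have -> : - 1 - (m%:Z - 1) = - m%:Z by lia.
  by rewrite fl fr cjK.
by rewrite !fz ?rmorph0 //; lia.
Qed.

Lemma monic_linear (p : {poly K}) : p \is monic -> size p = 2 -> p = 'X + (p`_0)%:P.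
Proof.
move=> mp sp; apply/polyP => i; rewrite coefD coefX coefC.
case: i => [|[|i]]; rewrite ?add0r ?addr0 //.
  by have := monicP mp; rewrite lead_coefE sp.
by rewrite nth_default ?sp.
Qed.

Lemma coef0_exp (p : {poly K}) k : (p ^+ k)`_0 = p`_0 ^+ k.
Proof. by rewrite -!horner_coef0 horner_exp. Qed.

Lemma fragment_not_annulled (p : {poly K}) k n a0 a :
    p \is monic -> irreducible_poly p -> size (p ^+ k.+1) = n.+1 -> a0 != 0 ->
    (~~ odd n -> forall alpha, p = 'X + alpha%:P -> alpha ^+ n.-1 * cj a0 + a0 != 0) ->
    fragment (uphalf n) a0 a ->
  exists l, act (p ^+ k) a l != 0.
Proof.
set m := uphalf n => mp [sp _] sz a00 lin [fl [fr fz]].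
case szp: (size p) sp => [|[|q]] // _.
pose d := (q.+1 * k)%N.
have szk : size (p ^+ k) = d.+1.
  rewrite /d -[q.+1]/(q.+2.-1) -szp -size_exp prednK // size_poly_gt0 monic_neq0 //.
  by apply: monic_exp.
have mk : p ^+ k \is monic by exact: monic_exp.
have def_n : n = (d + q.+1)%N.
  by have := size_exp p k.+1; rewrite sz szp /= mulnS addnC.
have m_gt0 : (0 < m)%N by rewrite /m; lia.
(* The degree [d] of [p ^+ k] is at most the number of zeros between the end terms: placing the
   leading coefficient on the right end leaves only [a0]. *)
have [small|large] := leqP d (m + m - 2).
  exists (m%:Z - 1 - d%:Z); rewrite (act_monic _ _ mk szk) subrK fr.
  by rewrite big1 ?addr0 // => i _; rewrite fz ?mulr0 //; have := ltn_ord i; lia.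
(* Otherwise [d = 2m - 1], so [p] is linear, [n] is even, and both end terms survive; this is the
   case [lin] controls. *)
have [q0 n2m] : q = 0%N /\ n = (m + m)%N by rewrite /m in large *; lia.
have [d' ed] : exists d', d = d'.+1 by exists d.-1; lia.
exists (- m%:Z); rewrite ed in szk; rewrite (act_monic _ _ mk szk).
have -> : - m%:Z + d'.+1%:Z = m%:Z - 1 by lia.
rewrite big_ord_recl addr0 fl fr big1 ?addr0 => [|i _].
  have dk : k = n.-1 by rewrite def_n /d q0 mul1n addn1.
  rewrite coef0_exp addrC dk; apply: lin; last by apply: monic_linear; rewrite ?szp ?q0.
  by rewrite n2m addnn odd_double.
by rewrite lift0 fz ?mulr0 //; have := ltn_ord i; lia.
Qed.

(** For even [n] the fragment is exactly a set of free initial values. For odd [n] it has one term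
    more, which the recurrence forces; the closing condition says that this term is [a0]. *)
Lemma exists_fragment chi n a0 : chi \is monic -> size chi = n.+1 ->
    (0 < n)%N -> chi`_0 != 0 -> (odd n -> chi`_0 * cj a0 + a0 = 0) ->
  exists2 a : int -> K, (forall l, act chi a l = 0) & fragment (uphalf n) a0 a.
Proof.
set m := uphalf n => mchi szchi; case: n => // n in m szchi * => _ c0 closing.
pose w (i : nat) := if i == 0%N then cj a0 else if i == (m + m).-1 then a0 else 0.
have [a ra aw] := exists_recurrent mchi szchi w (- m%:Z) c0.
have m_gt0 : (0 < m)%N by rewrite /m; lia.
have fl : a (- m%:Z) = cj a0 by have := aw 0%N isT; rewrite addr0.
have fz (i : int) : - m%:Z < i -> i < m%:Z - 1 -> a i = 0.
  move=> i1 i2; have -> : i = - m%:Z + (absz (i + m%:Z))%:Z by lia.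
  rewrite aw; last by rewrite /m in i1 i2 *; lia.
  by rewrite /w !ifF //; apply/eqP; lia.
exists a => //; split=> //; split=> //.
case: (boolP (odd n.+1)) => [odd_n | even_n]; last first.
  have -> : m%:Z - 1 = - m%:Z + n%:Z by rewrite /m; lia.
  rewrite aw // /w; have en : n = (m + m).-1 by rewrite /m; lia.
  by rewrite -en eqxx ifF //; apply/eqP; lia.
have := ra (- m%:Z); rewrite (act_monic _ _ mchi szchi) big_ord_recl addr0 fl.
rewrite big1 ?addr0 => [e|i _]; last first.
  by rewrite lift0 fz ?mulr0 //; have := ltn_ord i; rewrite /m; lia.
have -> : m%:Z - 1 = - m%:Z + n.+1%:Z by rewrite /m; lia.
apply: (addIr (chi`_0 * cj a0)); rewrite e addrC; exact/esym/closing.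
Qed.

(** Shows that [a = chi(-1)] meets the closing condition for odd [n]: self-duality exchanges the
    coefficients [i] and [n - i], whose signs at -1 are opposite. *)
Lemma horner_polyvee_opp1 chi n : chi \is monic -> size chi = n.+1 -> odd n ->
  chi = polyvee cj chi -> chi`_0 * cj chi.[-1] + chi.[-1] = 0.
Proof.
move=> mchi szchi odd_n dual.
have lc : chi`_n = 1 by have := monicP mchi; rewrite lead_coefE szchi.
have c0 : chi`_0 = (cj chi`_0)^-1.
  by rewrite {1}(polyvee_coef dual szchi (leq0n n)) subn0 lc rmorph1 mulr1.
rewrite horner_coef szchi rmorph_sum mulr_sumr (reindex_inj rev_ord_inj) /=.
rewrite -big_split big1 //= => i _; have le_in : (i <= n)%N by rewrite -ltnS.
rewrite subSS rmorphM rmorphXn rmorphN1 mulrA {1}c0 -(polyvee_coef dual szchi le_in).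
rewrite -mulrDr -signr_odd oddB // odd_n -[X in _ + X]signr_odd.
by case: (odd i); rewrite ?expr0 ?expr1 ?addNr ?addrN mulr0.
Qed.

Lemma fragment_toeplitz (p : {poly K}) k n a0 a :
    let chi := p ^+ k.+1 in
    p \is monic -> irreducible_poly p -> size chi = n.+1 ->
    chi`_0 != 0 -> chi = polyvee cj chi -> a0 != 0 ->
    (~~ odd n -> forall alpha, p = 'X + alpha%:P -> alpha ^+ n.-1 * cj a0 + a0 != 0) ->
    (forall l, act chi a l = 0) -> fragment (uphalf n) a0 a ->
  let X := \matrix_(i < n, j < n) a ((j : nat)%:Z - (i : nat)%:Z) in
  X \in unitmx /\ X = mxstar cj X *m frob_block n chi.
Proof.
move=> chi mp irr sz c0 dual a00 lin ra fr X.
have mchi : chi \is monic by apply: monic_exp.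
have [l nz] := fragment_not_annulled mp irr sz a00 lin fr.
split; first exact: (toeplitz_unitmx mp irr sz c0 ra nz).
apply: toeplitz_cosquare => //; apply: (fragment_symmetric mchi sz _ c0 dual ra fr).
exact: irreducible_power_degree_gt0 irr sz.
Qed.

End Fragments.

(** * Assembly of necessity, sufficiency and the explicit solution *)

Lemma cosquare_necessary (K : fieldType) (cj : {rmorphism K -> K}) (p : {poly K})
    k n (X : 'M[K]_n) :
    let chi := p ^+ k.+1 in
    (2%:R : K) != 0 -> involutive cj -> p \is monic -> irreducible_poly p ->
    size chi = n.+1 -> X \in unitmx -> X = mxstar cj X *m frob_block n chi ->
  (chi`_0 != 0 /\ chi = polyvee cj chi) /\
  ((forall x, cj x = x) -> p != 'X + ((-1) ^+ n.-1)%:P).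
Proof.
move=> chi two_neq0 cjK mp irr szchi uX eqX.
have n_gt0 := irreducible_power_degree_gt0 irr szchi.
have mchi : chi \is monic by apply: monic_exp.
case: n => // n in X szchi uX eqX n_gt0 *; split.
  split; first exact: cosquare_coef0 mchi szchi uX eqX.
  exact: (cosquare_polyvee mchi szchi cjK uX eqX).
move=> idcj; apply/eqP => /= def_p.
have kn : k = n.
  have := size_exp p k.+1; rewrite -/chi szchi def_p size_XaddC mul1n /=.
  by case.
apply: (cosquare_identity_excluded two_neq0 uX).
have <- : chi = ('X + ((-1) ^+ n)%:P) ^+ n.+1 by rewrite /chi kn def_p.
rewrite {1}eqX; congr (_ *m _).
by apply/matrixP => i j; rewrite !mxE idcj.
Qed.

Unset Implicit Arguments.
Set Strict Implicit.

Theorem theorem7 (K : fieldType) (cj : {rmorphism K -> K})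
    (n s : nat) (p chi : {poly K}) :
  (2 \notin [pchar K])%N ->
  involutive cj ->
  p \is monic -> irreducible_poly p ->
  (0 < s)%N -> chi = p ^+ s -> size chi = n.+1 ->
  let Phi := frob_block n chi in
  let A1 := chi`_0 != 0 /\ chi = polyvee cj chi in
  let A2 := (forall x, cj x = x) -> p != 'X + ((-1) ^+ n.-1)%:P in
  let m := uphalf n in
  let lo := Num.min (1 - n%:Z) (- m%:Z) in
  let caseB := if ~~ odd n
               then exists alpha, p = 'X + alpha%:P /\ alpha ^+ n.-1 = -1
               else p = 'X + 1 in
  let valid (a0 : K) :=
      if ~~ odd n then
        (~ caseB /\ a0 = 1) \/ (caseB /\ cj a0 = - a0 /\ a0 != 0)
      else
        (caseB /\ cj a0 = - a0 /\ a0 != 0) \/ (~ caseB /\ a0 = chi.[-1]) in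
  let frag (a0 : K) (a : int -> K) :=
      a (- m%:Z) = cj a0 /\ a (m%:Z - 1) = a0 /\
      (forall i : int, - m%:Z < i -> i < m%:Z - 1 -> a i = 0) in
  ((exists X : 'M[K]_n, X \in unitmx /\ X = mxstar cj X *m Phi) <-> A1 /\ A2)
  /\
  (A1 -> A2 -> forall a0 : K, valid a0 ->
     (exists a : int -> K, frag a0 a /\ recurrent chi a lo (n%:Z - 1)) /\
     (forall a : int -> K, frag a0 a -> recurrent chi a lo (n%:Z - 1) ->
        let X := \matrix_(i < n, j < n) a ((j : nat)%:Z - (i : nat)%:Z) in
        X \in unitmx /\ X = mxstar cj X *m Phi)).
Proof.
move=> char2 cjK mp irr; case: s => // k _ def_chi szchi Phi A1 A2 m lo caseB valid frag.
have two_neq0 : (2%:R : K) != 0 by move: char2; rewrite inE.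
have n_gt0 : (0 < n)%N by apply: (@irreducible_power_degree_gt0 K p k); rewrite -?def_chi.
have mchi : chi \is monic by rewrite def_chi; apply: monic_exp.
have self_dual0 : A1 -> chi`_0 * cj chi`_0 = 1.
  case=> c0 dual; rewrite {1}(polyvee_coef dual szchi (leq0n n)) subn0.
  have := monicP mchi; rewrite lead_coefE szchi /= => ->.
  by rewrite rmorph1 mulr1 mulVf // fmorph_eq0.
have valid_neq0 a0 : valid a0 -> a0 != 0.
  rewrite /valid /caseB; case: (odd n) => /=; last first.
    by case=> [[_ ->]|[_ []//]]; rewrite oner_eq0.
  case=> [[_ []]//|[np ->]]; apply/negP => /eqP; rewrite def_chi horner_exp => /eqP.
  (* If chi(-1) = 0, then -1 is a root of the irreducible monic [p], so [p = 'X + 1], which this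
     case excludes. *)
  rewrite expf_eq0 /= -/(root p (- 1)) => rp; apply: np.
  have : 'X - (- 1)%:P %| p by rewrite dvdp_XsubCl; exact: rp.
  have [_ irrp] := irr; move/irrp; rewrite size_XsubC => /(_ isT).
  by rewrite eqp_monic ?monicXsubC // => /eqP<-; rewrite polyCN opprK.
have valid_closing a0 : A1 -> valid a0 -> odd n -> chi`_0 * cj a0 + a0 = 0.
  move=> [c0 dual] va odd_n; move: va; rewrite /valid /caseB odd_n /=.
  case=> [[pX1 [cja _]]|[_ ->]]; last exact: horner_polyvee_opp1 szchi odd_n dual.
  by rewrite def_chi coef0_exp pX1 coefD coefX coef1 add0r expr1n mul1r cja addNr.
have valid_linear a0 : valid a0 -> ~~ odd n -> forall alpha, p = 'X + alpha%:P ->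
    alpha ^+ n.-1 * cj a0 + a0 != 0.
  move=> va even_n alpha def_p; move: va; rewrite /valid /caseB even_n.
  case=> [[nB ->]|[[beta [def_p' eb]] [-> a00]]].
    rewrite rmorph1 mulr1 addr_eq0; apply/eqP => e; apply: nB.
    by exists alpha.
  have -> : alpha = beta.
    have := congr1 (fun q : {poly K} => q`_0) def_p.
    by rewrite /= {1}def_p' !coefD !coefX !coefC !add0r.
  (* The value is [2 a0], nonzero in characteristic other than 2. *)
  by rewrite eb mulN1r opprK -mulr2n -mulr_natl mulf_neq0.
have solution a0 a : A1 -> valid a0 -> frag a0 a -> recurrent chi a lo (n%:Z - 1) ->
    let X := \matrix_(i < n, j < n) a ((j : nat)%:Z - (i : nat)%:Z) in
    X \in unitmx /\ X = mxstar cj X *m Phi.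
  move=> A1h va [fl [fr fz]] rec_a X; have [c0 dual] := A1h.
  (* Taking the minimum in [lo] makes the window cover both the Toeplitz indices from [1 - n] on and
     the left end [- m], which lies further left when [n = 1]. *)
  have window : lo + n%:Z - 1 <= n%:Z - 1 by rewrite /lo; lia.
  have [b rb ab] := recurrent_extension mchi szchi c0 n_gt0 window rec_a.
  have frb : fragment cj m a0 b.
    split; first by rewrite -ab // /lo /m; lia.
    split; first by rewrite -ab // /lo /m; lia.
    by move=> i i1 i2; rewrite -ab ?fz // /lo; move: i1 i2; rewrite /m; lia.
  have -> : X = \matrix_(i < n, j < n) b ((j : nat)%:Z - (i : nat)%:Z).
    apply/matrixP => i j; rewrite !mxE ab //.
    by have := ltn_ord i; have := ltn_ord j; rewrite /lo; lia.
  rewrite /Phi; move: szchi c0 dual rb (valid_linear a0 va); rewrite def_chi.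
  move=> sz c0 dual rb lin.
  exact: (fragment_toeplitz cjK mp irr sz c0 dual (valid_neq0 a0 va) lin rb frb).
have existence a0 : A1 -> valid a0 ->
    exists a : int -> K, frag a0 a /\ recurrent chi a lo (n%:Z - 1).
  move=> A1h va; have [c0 _] := A1h.
  have [a ra fra] := exists_fragment mchi szchi n_gt0 c0 (valid_closing a0 A1h va).
  by exists a; split=> // l _ _; apply: ra.
split; last by move=> A1h _ a0 va; split; [exact: existence | move=> a; exact: solution].
split.
  case=> X [uX eqX]; rewrite /A1 /A2; move: szchi eqX; rewrite /Phi def_chi => sz eqX.
  exact: cosquare_necessary two_neq0 cjK mp irr sz uX eqX.
move=> [A1h A2h].
suff [a0 va] : exists a0, valid a0.
  have [a [fra ra]] := existence a0 A1h va.
  by exists (\matrix_(i < n, j < n) a ((j : nat)%:Z - (i : nat)%:Z)); apply: solution va fra ra.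
have skew : caseB -> exists a0, cj a0 = - a0 /\ a0 != 0.
  move=> hB; have [idcj|] := classic (forall x, cj x = x); last first.
    case/not_all_ex_not => x cjx; exists (x - cj x).
    by rewrite rmorphB cjK opprB subr_eq0; split=> //; apply/eqP => /esym.
  (* With the identity involution no nonzero skew element is available, so the exceptional case must
     contradict A2. *)
  case/negP: (A2h idcj); move: hB (self_dual0 A1h); rewrite /caseB.
  rewrite def_chi coef0_exp idcj; case: (boolP (odd n)) => [odd_n|even_n] /=.
    move=> -> _; apply/eqP; congr (_ + _).
    by rewrite -signr_odd; have -> : odd n.-1 = false by lia; rewrite expr0.
  case=> alpha [def_p ea] c02.
  have kn : n = k.+1.
    have := size_exp p k.+1; rewrite -def_chi szchi def_p size_XaddC mul1n.
    by [].
  (* Self-duality makes the square of alpha^n equal to 1, and alpha^n = -alpha; as [n - 1] is odd,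
     alpha = alpha^(n-1) = -1, the value A2 forbids. *)
  have al2 : alpha * alpha = 1.
    move: c02; rewrite def_p coefD coefX coefC add0r exprSr.
    by rewrite kn /= in ea; rewrite ea mulN1r mulrNN.
  have al : alpha ^+ n.-1 = alpha.
    rewrite -(odd_double_half n.-1) (_ : odd n.-1 = true); last by lia.
    by rewrite exprS -muln2 mulnC exprM expr2 al2 expr1n mulr1.
  by rewrite def_p -al ea -signr_odd (_ : odd n.-1 = true) //; lia.
rewrite /valid; case: (classic caseB) => [hB|nB].
  have [a0 ha0] := skew hB; exists a0.
  by case: (odd n) => /=; [left | right].
by case: (odd n) => /=; [exists chi.[-1]; right | exists 1; left].
Qed.
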